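(* Let $q=e^{i\gamma}$, where $\gamma\in\Bigl(\arccos\sqrt{\tfrac18(1+\sqrt5)}\,,\ \tfrac{\pi}{2}\Bigr)$. Let $n\ge 1$, let $I\in\mathrm{Mat}(n,\mathbb C)$ be the identity matrix, and let $T\in\mathrm{Mat}(n^2,\mathbb C)$ be a Hermitian matrix, $T\neq 0$, satisfying $$T^2=(q+q^{-1})\,T,\qquad (T\otimes I)(I\otimes T)(T\otimes I)-(I\otimes T)(T\otimes I)(I\otimes T)=T\otimes I-I\otimes T,$$ where $\otimes$ is the Kronecker product. Then $T=[2]\,(I\otimes I)$, where $[2]=q+q^{-1}$. *)

(* Defs.v *)
From mathcomp Require Import all_boot all_order all_algebra.
From mathcomp Require Import reals trigo.
From mathcomp Require Import complex mxtens.

Set Implicit Arguments.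
Unset Strict Implicit.
Unset Printing Implicit Defensive.

Import Order.TTheory GRing.Theory Num.Theory.
Local Open Scope ring_scope.
Local Open Scope complex_scope.

(* The complex exponential is not available in the libraries imported here;
   e^{i t} is taken by Euler's formula. *)
Definition expi (R : realType) (t : R) : R[i] := cos t +i* sin t.

Definition qtwo (F : fieldType) (q : F) : F := q + q^-1.

(* For an operator T on V (x) V with dim V = n: T (x) I and I (x) T on
   V (x) V (x) V.  [*t] is the Kronecker product with row-major indices,
   (i, j) |-> i * n + j, for which both bracketings of a triple index give the
   same number, so the cast along [mulnA] leaves the entries in place. *)
Definition tensl (K : pzRingType) (n : nat) (T : 'M[K]_(n * n)) :
    'M[K]_(n * n * n) :=
  T *t (1%:M : 'M[K]_n).

Definition tensr (K : pzRingType) (n : nat) (T : 'M[K]_(n * n)) :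
    'M[K]_(n * n * n) :=
  castmx (mulnA n n n, mulnA n n n) ((1%:M : 'M[K]_n) *t T).

(* Main.v *)
(** Put [P = T / [2]], an orthogonal projection, and [t = [2]^-2].  On the
    fourth tensor power of the space, the projections [a = P (x) I (x) I],
    [b = I (x) P (x) I] and [c = I (x) I (x) P] satisfy
    [aba - t a = bab - t b] and [bcb - t b = cbc - t c].  Suppose [v] is fixed
    by [a] and killed by [c], and let [m = |v|^2], [s = |b v|^2].  The two
    relations give [|a b v|^2 = s - t m + t s] and [|c b v|^2 = t s], so
    [t m <= (1 + t) s], while Cauchy-Schwarz between [v] and [(1 - c) b v] gives
    [s^2 <= (1 - t) s m].  If [m > 0], these force [t <= 1 - t^2].  The range of
    [gamma] says exactly that [t + t^2 > 1], hence [a (1 - c) = P (x) (1 - P)]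
    vanishes, that is [P = 0] or [P = 1]. *)

Require Import Defs.
From mathcomp Require Import all_boot all_order all_algebra.
From mathcomp Require Import reals trigo complex mxtens ring lra.

Set Implicit Arguments.
Unset Strict Implicit.
Unset Printing Implicit Defensive.

Import Order.TTheory GRing.Theory Num.Theory.
Local Open Scope ring_scope.
Local Open Scope sesquilinear_scope.
Local Notation "''[' u , v ]" := (dotmx u v) : ring_scope.
Local Notation "''[' u ]" := '[u, u]%R : ring_scope.

(** * Casts and Kronecker products of square matrices *)

Lemma castmx_sqmul (K : comPzRingType) m m' (e : m = m') (A B : 'M[K]_m) :
  castmx (e, e) (A *m B) = castmx (e, e) A *m castmx (e, e) B.
Proof. by case: m' / e. Qed.

Lemma castmx_sqB (K : comPzRingType) m m' (e : m = m') (A B : 'M[K]_m) :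
  castmx (e, e) (A - B) = castmx (e, e) A - castmx (e, e) B.
Proof. by case: m' / e. Qed.

Lemma castmx_sqZ (K : comPzRingType) m m' (e : m = m') a (A : 'M[K]_m) :
  castmx (e, e) (a *: A) = a *: castmx (e, e) A.
Proof. by case: m' / e. Qed.

Lemma castmx_sq0 (K : comPzRingType) m m' (e : m = m') :
  castmx (e, e) (0 : 'M[K]_m) = 0.
Proof. by case: m' / e. Qed.

Lemma tensmx_castl (K : comPzRingType) m m' n (e : m = m')
    (e' : (m * n = m' * n)%N)
    (A : 'M[K]_m) (B : 'M[K]_n) :
  castmx (e, e) A *t B = castmx (e', e') (A *t B).
Proof. by case: m' / e e' => e'; rewrite !castmx_id. Qed.

Lemma tensmx_castr (K : comPzRingType) m n n' (e : n = n')
    (e' : (m * n = m * n')%N)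
    (A : 'M[K]_m) (B : 'M[K]_n) :
  A *t castmx (e, e) B = castmx (e', e') (A *t B).
Proof. by case: n' / e e' => e'; rewrite !castmx_id. Qed.

Lemma tensmxA (K : comPzRingType) m n p (e : (m * (n * p) = m * n * p)%N)
    (A : 'M[K]_m) (B : 'M[K]_n) (C : 'M[K]_p) :
  castmx (e, e) (A *t (B *t C)) = A *t B *t C.
Proof.
have E (i : 'I_m) (j : 'I_n) (k : 'I_p) :
    cast_ord (esym e) (mxtens_index (mxtens_index (i, j), k))
    = mxtens_index (i, mxtens_index (j, k)).
  by apply: val_inj; rewrite /= mulnDl mulnA addnA.
apply/matrixP => x y.
case: (mxtens_indexP x) => x12 x3; case: (mxtens_indexP y) => y12 y3.
case: (mxtens_indexP x12) => x1 x2; case: (mxtens_indexP y12) => y1 y2.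
by rewrite castmxE /= !E !tensmxE mulrA.
Qed.

Lemma tensmx11 (K : comPzRingType) m n :
  (1%:M : 'M[K]_m) *t (1%:M : 'M[K]_n) = 1%:M.
Proof.
apply/matrixP => x y.
case: (mxtens_indexP x) => i j; case: (mxtens_indexP y) => k l.
rewrite tensmxE !mxE -natrM mulnb; congr (_ %:R); congr nat_of_bool.
by rewrite (can_eq (@mxtens_indexK m n)).
Qed.

Lemma tensmxBl (K : comPzRingType) m n (A B : 'M[K]_m) (C : 'M[K]_n) :
  (A - B) *t C = A *t C - B *t C.
Proof. by apply/matrixP => i j; rewrite !mxE mulrBl. Qed.

Lemma tensmxBr (K : comPzRingType) m n (A : 'M[K]_m) (B C : 'M[K]_n) :
  A *t (B - C) = A *t B - A *t C.
Proof. by apply/matrixP => i j; rewrite !mxE mulrBr. Qed.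

Lemma tensmxZl (K : comPzRingType) m n a (A : 'M[K]_m) (C : 'M[K]_n) :
  (a *: A) *t C = a *: (A *t C).
Proof. by apply/matrixP => i j; rewrite !mxE mulrA. Qed.

Lemma tensmxZr (K : comPzRingType) m n a (A : 'M[K]_m) (C : 'M[K]_n) :
  A *t (a *: C) = a *: (A *t C).
Proof. by apply/matrixP => i j; rewrite !mxE mulrCA. Qed.

(** Each nonzero entry of [A] puts a nonzero multiple of all of [B] into the product. *)
Lemma tensmx_eq0 (K : idomainType) m n (A : 'M[K]_m) (B : 'M[K]_n) :
  (A *t B == 0) = (A == 0) || (B == 0).
Proof.
apply/eqP/orP => [AB0|[] /eqP->]; rewrite ?tens0mx ?tensmx0 //.
case: (eqVneq A 0) => [|/matrix0Pn [i [j Aij]]]; [by left | right].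
apply/eqP/matrixP => k l; rewrite mxE; apply/eqP.
pose x := mxtens_index (i, k); pose y := mxtens_index (j, l).
have /eqP := congr1 (fun M : 'M_(m * n) => M x y) AB0.
by rewrite tensmxE mxE mulf_eq0 (negPf Aij).
Qed.

(** * The inequality for three Hermitian projections *)

Lemma dotmx_mulr (C : numClosedFieldType) n (M : 'M[C]_n) (u v : 'rV[C]_n) :
  M ^t* = M -> '[u, v *m M] = '[u *m M, v].
Proof.
by move=> MH; rewrite !dotmxE trmx_mul map_mxM -[in LHS]MH trmxCK mulmxA.
Qed.

Lemma mixed_vector_eq0 (C : numClosedFieldType) n (t : C)
    (a b c : 'M[C]_n) (v : 'rV[C]_n) :
  a ^t* = a -> b ^t* = b -> c ^t* = c ->
  a *m a = a -> b *m b = b -> c *m c = c ->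
  a *m b *m a - t *: a = b *m a *m b - t *: b ->
  b *m c *m b - t *: b = c *m b *m c - t *: c ->
  0 < t -> 1 < t + t ^+ 2 ->
  v *m a = v -> v *m c = 0 -> v = 0.
Proof.
move=> aH bH cH aa bb cc hab hbc t0 t1 va vc; apply/eqP.
(* Vectors are rows acted on from the right: [v *m b *m a] is the vector $abv$ of the overview. *)
set s := '[v *m b, v].
have Eb : '[v *m b] = s by rewrite dotmx_mulr // -mulmxA bb.
have Ebcb : v *m b *m c *m b = t *: (v *m b).
  move/(congr1 (mulmx v)): hbc.
  rewrite !mulmxBr -!scalemxAr !mulmxA vc !mul0mx scaler0 subrr.
  by move/eqP; rewrite subr_eq0 => /eqP.
have Ebc_b : '[v *m b *m c, v *m b] = t * s.
  by rewrite dotmx_mulr // Ebcb linearZl.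
have Ebc : '[v *m b *m c] = t * s.
  by rewrite dotmx_mulr // -mulmxA cc Ebc_b.
have Eba : '[v *m b *m a] = s - t * '[v] + t * s.
  rewrite dotmx_mulr // -mulmxA aa dotmx_mulr //.
  have -> : v *m b *m a *m b = v *m b *m a - t *: v + t *: (v *m b).
    move/(congr1 (mulmx v)): hab.
    rewrite !mulmxBr -!scalemxAr !mulmxA va => ->.
    by rewrite subrK.
  by rewrite linearDl linearBl !linearZl /= -(dotmx_mulr (M := a)) ?va.
have s0 : 0 <= s by rewrite -Eb dnorm_ge0.
(* As [v] is killed by $c$, the part [v *m b *m c] is orthogonal to it and does not change the
   pairing. *)
have Ez : '[v *m b - v *m b *m c, v] = s.
  by rewrite linearBl /= -(dotmx_mulr (M := c)) // vc linear0r subr0.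
have Ezz : '[v *m b - v *m b *m c] = s - t * s.
  have Ez' : '[v *m b, v *m b *m c] = t * s.
    by rewrite dotmx_mulr // -Ebc_b.
  by rewrite linearBl !linearBr /= Ebc Ebc_b Ez' Eb subrr subr0.
have := CauchySchwarz (@dotmx C n) (v *m b - v *m b *m c) v.
rewrite /= Ez Ezz ger0_norm // => -[CS _].
have : 0 <= '[v *m b *m a] by rewrite dnorm_ge0.
rewrite Eba addrAC subr_ge0 => le_tm.
rewrite -(dnorm_eq0 (@dotmx C n)) -[_ == 0]negbK; apply/negP => v0.
have m_gt0 : 0 < '[v] by rewrite lt_def v0 dnorm_ge0.
(* From $0 < tm \le (1+t)s$; this allows $s$ to be cancelled in $s^2 \le (1-t)sm$. *)
have s_gt0 : 0 < s.
  have : 0 < s * (1 + t).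
    rewrite mulrDr mulr1 (mulrC s).
    by apply: lt_le_trans le_tm; rewrite mulr_gt0.
  by rewrite pmulr_lgt0 // ltr_wpDr // ltW.
have le_s : s <= (1 - t) * '[v].
  rewrite -(ler_pM2l s_gt0) mulrA; apply: le_trans CS _.
  by rewrite mulrBr mulr1 (mulrC s).
(* The two bounds chain as $tm \le (1+t)s \le (1+t)(1-t)m$. *)
have : t * '[v] <= (1 - t ^+ 2) * '[v].
  have /ltW t1' : 0 < 1 + t by rewrite ltr_wpDr // ltW.
  have := ler_wpM2l t1' le_s.
  rewrite mulrA (mulrC (1 + t) (1 - t)) -subr_sqr expr1n; apply: le_trans.
  by rewrite mulrDl mul1r.
by rewrite ler_pM2r // lerBrDr => /(lt_le_trans t1); rewrite ltxx.
Qed.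

(** * Projections on the fourth tensor power *)

Lemma castmx_ct (C : numClosedFieldType) m m' (e : m = m') (A : 'M[C]_m) :
  A ^t* = A -> (castmx (e, e) A) ^t* = castmx (e, e) A.
Proof. by case: m' / e; rewrite castmx_id. Qed.

Lemma tensmx_ct (C : numClosedFieldType) m n (A : 'M[C]_m) (B : 'M[C]_n) :
  A ^t* = A -> B ^t* = B -> (A *t B) ^t* = A *t B.
Proof. by move=> hA hB; rewrite trmx_tens map_mxT hA hB. Qed.

Lemma ct1 (C : numClosedFieldType) n : (1%:M : 'M[C]_n) ^t* = 1%:M.
Proof. by rewrite trmx1 map_mx1. Qed.

Lemma braided_projection (C : numClosedFieldType) n (t : C)
    (P : 'M[C]_(n * n)) :
  0 < t -> 1 < t + t ^+ 2 -> P ^t* = P -> P *m P = P ->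
  tensl P *m tensr P *m tensl P - t *: tensl P
    = tensr P *m tensl P *m tensr P - t *: tensr P ->
  P = 0 \/ P = 1%:M.
Proof.
move=> t0 t1 hP PP hbr.
have e4 : (n * (n * n * n) = n * n * n * n)%N by rewrite !mulnA.
have e22 : (n * n * (n * n) = n * n * n * n)%N by rewrite !mulnA.
(* [f] and [g] add a tensor factor on the right and on the left. Both are multiplicative and linear,
   so [hbr] yields the relation of $a$ and $b$ through [f], and that of $b$ and $c$ through [g];
   [fg] identifies the two copies of $b$. *)
pose f (X : 'M[C]_(n * n * n)) : 'M[C]_(n * n * n * n) := X *t 1%:M.
pose g (X : 'M[C]_(n * n * n)) : 'M[C]_(n * n * n * n) :=
  castmx (e4, e4) (1%:M *t X).
pose W := castmx (e22, e22) (P *t (1%:M - P)).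
have fl : f (tensl P) = castmx (e22, e22) (P *t 1%:M).
  by rewrite /f /tensl -tensmx11 tensmxA.
have gr : g (tensr P) = castmx (e22, e22) (1%:M *t P).
  have e' : (n * (n * (n * n)) = n * (n * n * n))%N by rewrite !mulnA.
  rewrite /g /tensr (tensmx_castr _ e') castmx_comp.
  have e3 : (n * (n * (n * n)) = n * n * (n * n))%N by rewrite !mulnA.
  rewrite -tensmx11 -(tensmxA e3) castmx_comp.
  by congr (castmx (_, _) _); apply: nat_irrelevance.
have fg : f (tensr P) = g (tensl P).
  have e' : (n * (n * n) * n = n * n * n * n)%N by rewrite !mulnA.
  have e3 : (n * ((n * n) * n) = n * (n * n) * n)%N by rewrite !mulnA.
  rewrite /f /g /tensl /tensr (tensmx_castl _ e') -(tensmxA e3) castmx_comp.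
  by congr (castmx (_, _) _); apply: nat_irrelevance.
have fM X Y : f (X *m Y) = f X *m f Y by rewrite /f tensmx_mul mulmx1.
have gM X Y : g (X *m Y) = g X *m g Y.
  by rewrite /g -castmx_sqmul tensmx_mul mulmx1.
have fB X Y : f (X - Y) = f X - f Y by rewrite /f tensmxBl.
have gB X Y : g (X - Y) = g X - g Y by rewrite /g tensmxBr castmx_sqB.
have fZ x X : f (x *: X) = x *: f X by rewrite /f tensmxZl.
have gZ x X : g (x *: X) = x *: g X by rewrite /g tensmxZr castmx_sqZ.
have rr : tensr P *m tensr P = tensr P.
  by rewrite /tensr -castmx_sqmul tensmx_mul mulmx1 PP.
have rH : (tensr P) ^t* = tensr P.
  by apply/castmx_ct/tensmx_ct => //; apply: ct1.
have W0 : W = 0.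
  (* [W] is $a(1-c)$, and $Wa = W$, $Wc = 0$, so each of its rows is fixed by $a$ and killed by
     $c$. *)
  apply/row_matrixP => i; rewrite row0.
  apply: (@mixed_vector_eq0 _ _ t (f (tensl P)) (f (tensr P)) (g (tensr P))).
  - by rewrite fl; apply/castmx_ct/tensmx_ct => //; apply: ct1.
  - by apply/tensmx_ct => //; apply: ct1.
  - by rewrite gr; apply/castmx_ct/tensmx_ct => //; apply: ct1.
  - by rewrite fl -castmx_sqmul tensmx_mul mulmx1 PP.
  - by rewrite -fM rr.
  - by rewrite gr -castmx_sqmul tensmx_mul mulmx1 PP.
  - by have := congr1 f hbr; rewrite !fB !fZ !fM.
  - by have := congr1 g hbr; rewrite !gB !gZ !gM fg => ->.
  - by [].
  - by [].
  - by rewrite -row_mul fl -castmx_sqmul tensmx_mul PP mulmx1.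
  - rewrite -row_mul gr -castmx_sqmul tensmx_mul mulmxBl PP mul1mx subrr.
    by rewrite tensmx0 castmx_sq0 row0.
have /eqP : P *t (1%:M - P) = 0.
  by apply: (can_inj (castmxK e22 e22)); rewrite -/W W0 castmx_sq0.
rewrite tensmx_eq0 => /orP [/eqP-> | ]; first by left.
by rewrite subr_eq0 => /eqP <-; right.
Qed.

Lemma hecke_operator_scalar (C : numClosedFieldType) n (x : C)
    (T : 'M[C]_(n * n)) :
  0 < x -> x ^+ 4 < 1 + x ^+ 2 -> T ^t* = T -> T *m T = x *: T ->
  tensl T *m tensr T *m tensl T - tensr T *m tensl T *m tensr T
    = tensl T - tensr T ->
  T = 0 \/ T = x%:M.
Proof.
move=> x0 x4 hT TT hbr.
have xn0 : x != 0 by rewrite gt_eqF.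
have xV0 : 0 < x^-1 by rewrite invr_gt0.
pose P := x^-1 *: T.
have TP : T = x *: P by rewrite scalerA divff // scale1r.
suff [P0|P1] : P = 0 \/ P = 1%:M.
- by left; rewrite TP P0 scaler0.
- by right; rewrite TP P1 scalemx1.
have lZ y (A : 'M[C]_(n * n)) : tensl (y *: A) = y *: tensl A.
  by rewrite /tensl tensmxZl.
have rZ y (A : 'M[C]_(n * n)) : tensr (y *: A) = y *: tensr A.
  by rewrite /tensr tensmxZr castmx_sqZ.
apply: (@braided_projection _ _ (x ^- 2)).
- by rewrite invr_gt0 exprn_gt0.
(* With $t = x^{-2}$, the condition $t + t^2 > 1$ is $x^4 < 1 + x^2$ divided by $x^4$. *)
- have -> : x ^- 2 + (x ^- 2) ^+ 2 = (1 + x ^+ 2) / x ^+ 4 by field.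
  by rewrite ltr_pdivlMr ?mul1r // exprn_gt0.
- by rewrite /P linearZ /= map_mxZ /= hT conj_Creal // gtr0_real.
- by rewrite /P -scalemxAl -scalemxAr TT !scalerA divfK.
- rewrite /P !lZ !rZ -!(scalemxAl, scalemxAr) !scalerA.
  have -> : x ^- 2 * x^-1 = x^-1 * x^-1 * x^-1 :> C by field.
  rewrite -!scalerBr; congr (_ *: _).
  move/eqP: hbr; rewrite subr_eq => /eqP ->.
  by rewrite addrC !addrA addNr add0r addrC.
Qed.

(** * The range of gamma and the golden ratio *)

Lemma cos_gt_acos_golden (R : realType) (gamma : R) :
  acos (Num.sqrt (1 / 8 * (1 + Num.sqrt 5))) < gamma < pi / 2 ->
  0 < cos gamma /\ (cos gamma *+ 2) ^+ 4 < 1 + (cos gamma *+ 2) ^+ 2.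
Proof.
move=> hgamma.
have s5 : Num.sqrt 5 ^+ 2 = 5 :> R by rewrite sqr_sqrtr.
have s5_ge0 : 0 <= Num.sqrt 5 :> R by rewrite sqrtr_ge0.
(* From here on $\sqrt5$ is known only through $r^2 = 5$ and $r \ge 0$, which suits [lra] and
   [nra]. *)
set r : R := Num.sqrt 5 in s5 s5_ge0 hgamma; clearbody r.
set y : R := Num.sqrt _ in hgamma.
have y2 : y ^+ 2 = 1 / 8 * (1 + r) by rewrite sqr_sqrtr //; lra.
have y0 : 0 <= y by rewrite sqrtr_ge0.
(* Hence $y^2 = (1+r)/8 \le 1/2$, which places [y] in the domain of arccos. *)
have r3 : r <= 3 by nra.
have y1 : -1 <= y <= 1.
  apply/andP; split; first by lra.
  by rewrite -(@ler_pXn2r _ 2) // ?nnegrE // y2 expr1n; lra.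
case/andP: hgamma => lo hi.
have pi0 := pi_gt0 R.
have gpos : 0 <= gamma by apply: le_trans (ltW lo); apply: acos_ge0.
have c0 : 0 < cos gamma by apply: cos_gt0_pihalf; apply/andP; split; lra.
(* Cosine is decreasing on $[0,\pi]$. *)
have cy : cos gamma < y.
  have yI : acos y \in `[0, pi] by rewrite in_itv /= acos_ge0 ?acos_lepi.
  have gI : gamma \in `[0, pi] by rewrite in_itv /= gpos; lra.
  by rewrite -[ltRHS]acosK ?in_itv //= ltr_cos.
split=> //; set z := cos gamma *+ 2.
(* The bound is $4y^2$, the golden ratio. *)
have z2 : z ^+ 2 < (1 + r) / 2.
  have : cos gamma ^+ 2 < y ^+ 2 by rewrite ltr_pXn2r // nnegrE ltW.
  rewrite y2 /z; lra.
have z0 : 0 <= z ^+ 2 by rewrite sqr_ge0.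
rewrite -[4%N]/(2 * 2)%N exprM; move: (z ^+ 2) z0 z2 => w w0 w2.
(* Keeps the second factor of the product below positive even at $w = 0$. *)
have r1 : 1 < r by nra.
(* [(1 + r) / 2] and [(1 - r) / 2] are the roots of [w^2 - w - 1]. *)
have : 0 < ((1 + r) / 2 - w) * (w + (r - 1) / 2) by apply: mulr_gt0; lra.
nra.
Qed.

Theorem proposition5 (R : realType) (gamma : R) (q : R[i])
    (hgamma : acos (Num.sqrt (1 / 8 * (1 + Num.sqrt 5))) < gamma < pi / 2)
    (hq : q = expi gamma)
    (n : nat) (hn : (1 <= n)%N)
    (T : 'M[R[i]]_(n * n))
    (hT_herm : T \is hermsymmx)
    (hT_neq0 : T <> 0)
    (hT_sq : T *m T = qtwo q *: T)
    (hT_braid :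
      tensl T *m tensr T *m tensl T - tensr T *m tensl T *m tensr T
      = tensl T - tensr T) :
  T = qtwo q *: ((1%:M : 'M[R[i]]_n) *t (1%:M : 'M[R[i]]_n)).
Proof.
have q1 : qtwo q = ((cos gamma *+ 2)%:C)%C.
  (* Since $|q| = 1$, the inverse of $q$ is its conjugate, so $q + q^{-1}$ is the real number
     $2\cos\gamma$. *)
  have qV : q^-1 = (cos gamma -i* sin gamma)%C.
    apply: mulr1_eq; rewrite hq /expi; simpc.
    by rewrite -!expr2 cos2Dsin2 mulrC addNr.
  by rewrite /qtwo qV hq /expi; simpc; rewrite mulr2n.
have [c0 c4] := cos_gt_acos_golden hgamma.
have Q_gt0 : 0 < qtwo q by rewrite q1 ltcR pmulrn_lgt0.
have Q4 : qtwo q ^+ 4 < 1 + qtwo q ^+ 2.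
  by rewrite q1 -(rmorph1 (real_complex R)) -!rmorphXn -rmorphD ltcR.
have hT : T ^t* = T.
  by move: hT_herm; rewrite is_hermitianmxE expr0 scale1r => /eqP.
have [//|->] := hecke_operator_scalar Q_gt0 Q4 hT hT_sq hT_braid.
by rewrite tensmx11 scalemx1.
Qed.
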